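(* Let $k\ge1$ and $l\ge1$ be integers, let $\mu'=(\mu'_1,\ldots,\mu'_k)$ be a partition with $\mu'_k\ge 2$, and let $\mu=(\mu'_1,\ldots,\mu'_k,2^l)$ be the partition obtained by appending $l$ parts equal to $2$. For a filling $T$ of shape $\mu$, let $T'$ be the filling of shape $\mu'$ with $T'_{i,j}=T_{i,j}$ for $(i,j)\in\mu'$, let $T''$ be the filling of shape $(2^l)$ with $T''_{i,j}=T_{k+i,j}$ for $1\le i\le l$, $1\le j\le 2$, and let $\tau(T)$ be the filling of shape $\mu$ produced by the procedure described below. Then for every filling $T$ of shape $\mu$, \[ \operatorname{maj}(\tau(T))\equiv \operatorname{maj}(T')+\operatorname{maj}(T'')\pmod{l} \quad\text{and}\quad \operatorname{inv}(\tau(T))=\operatorname{inv}(T')+\operatorname{inv}(T''). \]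
   Context: Diagrams are in French convention: the diagram of a partition $\lambda=(\lambda_1\ge\cdots\ge\lambda_r>0)$ is the set of cells $(i,j)$ with $1\le i\le r$, $1\le j\le\lambda_i$ (row $i$ counted from the bottom, column $j$ from the left). For a cell $u=(i,j)$, $\operatorname{arm}(u)=\lambda_i-j$ is the number of cells strictly to its right and $\operatorname{leg}(u)$ is the number of cells of the diagram strictly above it in column $j$. A filling $T$ of shape $\lambda$ assigns a positive integer $T_{i,j}$ to each cell, with no monotonicity condition. A descent of $T$ is a cell $(i,j)$ with $i\ge 2$ and $T_{i,j}>T_{i-1,j}$; $\operatorname{Des}(T)$ is the set of descents and $\operatorname{maj}(T)=\sum_{u\in\operatorname{Des}(T)}(\operatorname{leg}(u)+1)$. Two distinct cells attack each other if they lie in the same row, or if they are of the form $(i,k)$ and $(i-1,j)$ with $j<k$. The reading order reads rows from top to bottom and each row from left to right. A pair $(u,v)$ of cells is an inversion if $u,v$ attack each other, $T_u<T_v$, and $v$ precedes $u$ in the reading order; $\operatorname{Inv}(T)$ is the number of inversions and $\operatorname{inv}(T)=\operatorname{Inv}(T)-\sum_{u\in\operatorname{Des}(T)}\operatorname{arm}(u)$. Statistics are computed with respect to the shape of the filling in question. Conditions: given numbers $a,b,A$, the triple satisfies condition $xAx$ if $a\le A<b$ or $b\le A<a$. Given numbers $a,b,A,B$, the quadruple satisfies condition $xXxX$ if one of the following holds: $a\le A<b\le B$; $A<b\le B<a$; $b\le A<a\le B$; $A<a\le B<b$; $a\le B<b\le A$; $B<b\le A<a$; $b\le B<a\le A$;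 $B<a\le A<b$. For a filling $S$ and a row index $i$ with row $i+1$ of length $2$, ''rows $i$ and $i+1$ of $S$ satisfy $xAx$'' means $(a,b,A)=(S_{i+1,1},S_{i+1,2},S_{i,1})$ satisfies $xAx$; when rows $i$ and $i+1$ both have length $2$, ''rows $i$ and $i+1$ satisfy $xXxX$'' means $(a,b,A,B)=(S_{i+1,1},S_{i+1,2},S_{i,1},S_{i,2})$ satisfies $xXxX$. Definition of $\tau(T)$: set $S\leftarrow T$ and $i\leftarrow k$. If rows $k$ and $k+1$ of $S$ do not satisfy $xAx$, return $S$. Otherwise swap the two entries of row $k+1$ of $S$ and set $i\leftarrow k+1$. Then, while $i+1\le k+l$ and rows $i$ and $i+1$ of the current $S$ satisfy $xXxX$, swap the two entries of row $i+1$ of $S$ and set $i\leftarrow i+1$. Return $S$; this is $\tau(T)$. *)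

(* Defs.v *)
From mathcomp Require Export all_boot.
From mathcomp Require Export ssralg ssrnum ssrint.

Set Implicit Arguments.
Unset Strict Implicit.
Unset Printing Implicit Defensive.

(* Rows and columns are numbered from 1, row 1 being the bottom row.  A shape
   is the sequence of its row lengths from bottom to top. *)

Definition is_partition (lam : seq nat) : bool :=
  sorted geq lam && all (leq 1) lam.

Definition part (lam : seq nat) (i : nat) : nat := nth 0 lam i.-1.

Definition cell : Type := (nat * nat)%type.

Definition diagram (lam : seq nat) : seq cell :=
  [seq (i, j) | i <- iota 1 (size lam), j <- iota 1 (part lam i)].

Lemma mem_diagram lam i j :
  ((i, j) \in diagram lam) = (1 <= i <= size lam) && (1 <= j <= part lam i).
Proof.
apply/allpairsPdep/andP => [[x [y [xP yP [-> ->]]]]|[iP jP]].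
  by move: xP yP; rewrite !mem_iota !add1n !ltnS.
by exists i, j; rewrite !mem_iota !add1n !ltnS.
Qed.

Definition arm (lam : seq nat) (u : cell) : nat := part lam u.1 - u.2.

Definition leg (lam : seq nat) (u : cell) : nat :=
  count (fun v : cell => (v.2 == u.2) && (u.1 < v.1)) (diagram lam).

(* A filling is a total function [T], with [T i j] the entry of cell (i, j);
   the shape is always given separately and the values outside its diagram
   are irrelevant. *)
Definition is_filling (lam : seq nat) (T : nat -> nat -> nat) : Prop :=
  forall i j, (i, j) \in diagram lam -> 0 < T i j.

Definition Des (lam : seq nat) (T : nat -> nat -> nat) : seq cell :=
  [seq u <- diagram lam | (2 <= u.1) && (T u.1.-1 u.2 < T u.1 u.2)].

Definition maj (lam : seq nat) (T : nat -> nat -> nat) : nat :=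
  \sum_(u <- Des lam T) (leg lam u).+1.

Definition attack (u v : cell) : bool :=
  [|| (u.1 == v.1) && (u.2 != v.2),
      (u.1 == v.1.+1) && (v.2 < u.2)
    | (v.1 == u.1.+1) && (u.2 < v.2)].

Definition precedes (v u : cell) : bool :=
  (u.1 < v.1) || (u.1 == v.1) && (v.2 < u.2).

Definition is_inversion (T : nat -> nat -> nat) (u v : cell) : bool :=
  [&& attack u v, T u.1 u.2 < T v.1 v.2 & precedes v u].

Definition Inv (lam : seq nat) (T : nat -> nat -> nat) : nat :=
  count (fun p : cell * cell => is_inversion T p.1 p.2)
        [seq (u, v) | u <- diagram lam, v <- diagram lam].

(* The library already uses the name [inv]. *)
Definition inv_stat (lam : seq nat) (T : nat -> nat -> nat) : int :=
  ((Inv lam T)%:Z - (\sum_(u <- Des lam T) arm lam u)%N%:Z)%R.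

Definition xAx (a b A : nat) : bool := (a <= A < b) || (b <= A < a).

Definition xXxX (a b A B : nat) : bool :=
  [|| (a <= A < b) && (b <= B),
      (A < b <= B) && (B < a),
      (b <= A < a) && (a <= B),
      (A < a <= B) && (B < b),
      (a <= B < b) && (b <= A),
      (B < b <= A) && (A < a),
      (b <= B < a) && (a <= A)
    | (B < a <= A) && (A < b)].

Definition rows_xAx (S : nat -> nat -> nat) (i : nat) : bool :=
  xAx (S i.+1 1) (S i.+1 2) (S i 1).

Definition rows_xXxX (S : nat -> nat -> nat) (i : nat) : bool :=
  xXxX (S i.+1 1) (S i.+1 2) (S i 1) (S i 2).

Definition swap_row (r : nat) (S : nat -> nat -> nat) : nat -> nat -> nat :=
  fun i j =>
    if (i == r) && (j == 1) then S i 2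
    else if (i == r) && (j == 2) then S i 1
    else S i j.

(* The while loop up to row [top]; [n] bounds the number of iterations. *)
Fixpoint tau_loop (n top : nat) (S : nat -> nat -> nat) (i : nat) :
    nat -> nat -> nat :=
  if n is n'.+1 then
    if (i.+1 <= top) && rows_xXxX S i
    then tau_loop n' top (swap_row i.+1 S) i.+1
    else S
  else S.

(* The loop starts at row k+1 and raises the row at each iteration, so it runs
   at most l-1 times: the bound l is never reached. *)
Definition tau (k l : nat) (T : nat -> nat -> nat) : nat -> nat -> nat :=
  if rows_xAx T k then tau_loop l (k + l) (swap_row k.+1 T) k.+1 else T.

Definition restrict (lam : seq nat) (T : nat -> nat -> nat) :
    nat -> nat -> nat :=
  fun i j => if (i, j) \in diagram lam then T i j else 0.

Definition lower_part (mu' : seq nat) (T : nat -> nat -> nat) :=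
  restrict mu' T.

Definition upper_part (k l : nat) (T : nat -> nat -> nat) :=
  restrict (nseq l 2) (fun i j => T (k + i) j).

(* Main.v *)
(* With [a b] the entries of a row of length 2 and [A B] the first two entries of
   the row below, the former adds [b<a] + [A<b] - [A<a] to the inversion statistic
   and (leg + 1) times [A<a] + [B<b] to the major index.  On the row k+1 the leg
   factor is l, hence invisible modulo l, and the swap dictated by xAx turns the
   inversion contribution into [b<a], which is what T'' sees.  Above it, swapping
   two consecutive rows under xXxX, or only the lower one when xXxX fails, keeps
   both contributions, so each step of tau leaves all the higher rows correct. *)
Require Import Defs.
From mathcomp Require Import zify.

Set Implicit Arguments.
Unset Strict Implicit.
Unset Printing Implicit Defensive.

(** * Diagrams and legs under appending rows of length 2 *)

Lemma diagram_cat lam nu :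
  diagram (lam ++ nu) =
    diagram lam ++ [seq (size lam + u.1, u.2) | u <- diagram nu].
Proof.
rewrite /diagram size_cat iotaD map_cat flatten_cat; congr (_ ++ _).
  congr flatten; apply/eq_in_map => i; rewrite mem_iota => iP.
  by rewrite /part nth_cat; case: ifP => //; lia.
rewrite addnC iotaDl allpairs_mapl map_allpairs; congr flatten.
apply/eq_in_map => i; rewrite mem_iota => iP.
rewrite /part nth_cat; case: ifP => [|_]; first by lia.
by congr map; congr iota; congr nth; lia.
Qed.

Lemma diagram_nseqS l :
  diagram (nseq l.+1 2) = diagram (nseq l 2) ++ [:: (l.+1, 1); (l.+1, 2)].
Proof. by rewrite -addn1 nseqD diagram_cat size_nseq. Qed.

Lemma uniq_diagram lam : uniq (diagram lam).
Proof.
apply: allpairs_uniq_dep => [|i _|]; rewrite ?iota_uniq //.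
by move=> [i j] [i' j'] _ _ /= [-> ->].
Qed.

Lemma big_diagram_nseq l (F : cell -> nat) :
  \sum_(u <- diagram (nseq l 2)) F u =
    \sum_(0 <= i < l) (F (i.+1, 1) + F (i.+1, 2)).
Proof.
elim: l => [|l IHl]; first by rewrite big_nil big_geq.
by rewrite big_nat_recr // diagram_nseqS big_cat IHl /= !big_cons big_nil addn0.
Qed.

Lemma leg_nseq l i j : 1 <= j <= 2 -> leg (nseq l 2) (i, j) = l - i.
Proof.
move=> jP; rewrite /leg; elim: l => [|l IHl] //.
by rewrite diagram_nseqS count_cat IHl /=; lia.
Qed.

(** The new rows put [l] cells on top of each of columns 1 and 2 and none on any other column. *)
Lemma leg_cat_nseq lam l i j : i <= size lam ->
  leg (lam ++ nseq l 2) (i, j) = leg lam (i, j) %[mod l].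
Proof.
move=> iP; rewrite /leg diagram_cat count_cat count_map /=.
set c := count _ (diagram (nseq l 2)).
suff -> : c = l * ((j == 1) || (j == 2)) by rewrite -modnDmr modnMr addn0.
rewrite {}/c -sum1_count big_mkcond big_diagram_nseq /=.
rewrite (eq_bigr (fun=> ((j == 1) || (j == 2)) : nat)) => [|r _].
  by rewrite sum_nat_const_nat subn0.
have -> : i < size lam + r.+1 by lia.
by rewrite !andbT; case: j => [|[|[|j]]].
Qed.

(** * Row-by-row decomposition of the two statistics *)

Section RowStatistics.
Implicit Types (lam : seq nat) (S : nat -> nat -> nat).

Definition row_des S i : nat := (S i 1 < S i.+1 1) + (S i 2 < S i.+1 2).

(* The contribution of row [i.+1] to [inv_stat]: the inversion inside the row,
   the inversion with row [i], and the arm of the first cell if it is a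
   descent. *)
Definition row_inv S i : int :=
  (((S i.+1 2 < S i.+1 1) + (S i 1 < S i.+1 2))%N%:Z
    - (S i 1 < S i.+1 1)%:Z)%R.

Lemma maj_nseq l S :
  maj (nseq l 2) S = \sum_(1 <= i < l) (l - i) * row_des S i.
Proof.
rewrite /maj big_filter big_mkcond big_diagram_nseq.
case: l => [|l]; first by rewrite !big_geq.
rewrite big_nat_recl // big_add1 add0n; apply: eq_big_nat => i /andP[_ il].
by rewrite !leg_nseq //= /row_des; do 2 case: ltnP => _; lia.
Qed.

Lemma maj_cat_nseq lam l S : 0 < size lam -> 0 < l ->
  maj (lam ++ nseq l 2) S =
    maj lam S + \sum_(1 <= i < l) (l - i) * row_des S (size lam + i) %[mod l].
Proof.
move=> lam_gt0 l_gt0; rewrite /maj !big_filter diagram_cat big_cat /= big_map.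
rewrite -modnDm -[RHS]modnDm; congr ((_ + _) %% _).
  rewrite -modn_summ -[RHS]modn_summ; congr (_ %% _).
  rewrite big_seq_cond [RHS]big_seq_cond; apply: eq_bigr => -[i j] /andP[].
  rewrite mem_diagram => uP _.
  have /= iP : i <= size lam by lia.
  apply/eqP; rewrite -(addn1 (leg lam _)) -(addn1 (leg _ _)) eqn_modDr.
  exact/eqP/leg_cat_nseq.
rewrite big_mkcond big_diagram_nseq /=.
have legE i j : 1 <= j <= 2 ->
    leg (lam ++ nseq l 2) (size lam + i, j) = l - i.
  move=> jP; rewrite /leg diagram_cat count_cat count_map /=.
  rewrite (eq_in_count (a2 := pred0)) => [|[r c]].
    rewrite count_pred0 add0n -(@leg_nseq l i j jP) /leg.
    by apply: eq_count => -[r c] /=; rewrite ltn_add2l.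
  by rewrite mem_diagram /=; lia.
rewrite (eq_big_nat _ _
    (F2 := fun i => (l - i) * row_des S (size lam + i))); last first.
  move=> i /andP[_ il]; rewrite !legE // addnS /= /row_des ltnS.
  have -> /= : 0 < size lam + i by lia.
  by do 2 case: ltnP => _; lia.
(* The term [i = 0], that of the first appended row, has coefficient [l] and vanishes modulo [l]. *)
by rewrite big_ltn // subn0 -modnDml modnMr add0n.
Qed.

Lemma Inv_sum lam S :
  Inv lam S = \sum_(u <- diagram lam) \sum_(v <- diagram lam)
                is_inversion S u v.
Proof. by rewrite /Inv -sum1_count big_mkcond big_allpairs. Qed.

(** The new row is read first. Outside the row its first cell attacks nothing, having no column to
    its left, and its second attacks only [(size lam, 1)]. *)
Lemma Inv_rcons2 lam S : 0 < part lam (size lam) ->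
  Inv (lam ++ [:: 2]) S =
    Inv lam S + (S (size lam).+1 2 < S (size lam).+1 1)
      + (S (size lam) 1 < S (size lam).+1 2).
Proof.
move=> last_gt0.
have lam_gt0 : 0 < size lam by case: lam last_gt0.
rewrite !Inv_sum diagram_cat big_cat /= addn1.
under eq_bigr do rewrite big_cat.
rewrite big_split /= -!addnA.
congr (_ + _); rewrite addnC; congr (_ + _).
  have above_lower j : \sum_(v <- diagram lam)
      is_inversion S ((size lam).+1, j) v = 0.
    rewrite big_seq big1 // => -[r c]; rewrite mem_diagram => vP.
    by rewrite /is_inversion /precedes /=; lia.
  rewrite !big_cons !big_nil !big_cat !above_lower /= !big_cons !big_nil /=.
  by rewrite /is_inversion /attack /precedes /= eqxx /= !ltnn !andbF; lia.
rewrite (bigD1_seq (size lam, 1)) ?uniq_diagram ?mem_diagram //=; last by lia.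
rewrite [X in _ + X]big_seq_cond [X in _ + X]big1 => [|[r c]].
  rewrite !big_cons big_nil /is_inversion /attack /precedes /=.
  by rewrite !eqxx; lia.
rewrite mem_diagram !big_cons big_nil xpair_eqE /is_inversion /attack /=.
lia.
Qed.

(** In the new row only the first cell has a nonzero arm, equal to 1. *)
Lemma sum_arm_rcons2 lam S : 0 < size lam ->
  \sum_(u <- Des (lam ++ [:: 2]) S) arm (lam ++ [:: 2]) u =
    \sum_(u <- Des lam S) arm lam u
      + (S (size lam) 1 < S (size lam).+1 1).
Proof.
move=> lam_gt0; rewrite !big_filter diagram_cat big_cat /= addn1.
congr (_ + _).
  rewrite big_seq_cond [RHS]big_seq_cond; apply: eq_bigr => -[i j] /andP[].
  rewrite mem_diagram /arm /part nth_cat /= => uP _.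
  by case: ifP => //; lia.
rewrite !big_cons big_nil /arm /part /= nth_cat ltnn subnn /= ltnS lam_gt0 /=.
by do 2 case: ifP.
Qed.

Lemma inv_stat_cat_nseq lam l S : 0 < part lam (size lam) ->
  inv_stat (lam ++ nseq l 2) S =
    (inv_stat lam S + \sum_(0 <= i < l) row_inv S (size lam + i))%R.
Proof.
move=> last_gt0; elim: l => [|l IHl].
  by rewrite cats0 big_geq // GRing.addr0.
have lam_gt0 : 0 < size lam by case: lam last_gt0 {IHl}.
rewrite big_nat_recr // -(addn1 l) nseqD catA GRing.addrA -IHl /inv_stat.
have sizeE : size (lam ++ nseq l 2) = size lam + l.
  by rewrite size_cat size_nseq.
rewrite Inv_rcons2; last first.
  rewrite sizeE /part nth_cat nth_nseq.
  case: l {IHl sizeE} => [|l].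
    by rewrite addn0; case: ifP => //; rewrite prednK // leqnn.
  by case: ifP; [lia | case: ifP; lia].
rewrite sum_arm_rcons2 sizeE; last by lia.
rewrite /row_inv !PoszD.
by move: (Posz _) (Posz _) (Posz _) (Posz _) (Posz _) => *; lia.
Qed.

Lemma inv_stat_nseq l S : 0 < l ->
  inv_stat (nseq l 2) S =
    ((S 1 2 < S 1 1)%:Z + \sum_(1 <= i < l) row_inv S i)%R.
Proof.
case: l => // l _.
(* The bottom row has nothing beneath it: it is split off and contributes only its inner
   inversion. *)
rewrite -[nseq _ 2]/([:: 2] ++ nseq l 2) inv_stat_cat_nseq // big_add1.
congr (_ + _)%R; rewrite /inv_stat /Inv /Des /= big_nil.
by rewrite /is_inversion /attack /precedes /= !andbF /= GRing.subr0 andbT !addn0.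
Qed.

(** A descent also reads the cell below. Since row lengths weakly decrease, that cell lies in the
    diagram too. *)
Lemma eq_Des lam S S' : is_partition lam ->
  {in diagram lam, forall u, S u.1 u.2 = S' u.1 u.2} -> Des lam S = Des lam S'.
Proof.
move=> /andP[lam_sorted _] eqS; apply: eq_in_filter => -[i j] /= uP.
case: leqP => //= i_gt1; rewrite (eqS _ uP) (eqS (i.-1, j)) //.
move: uP; rewrite !mem_diagram => uP.
have geq_trans : transitive geq by move=> y x z xy yz; apply: leq_trans xy.
have : nth 0 lam i.-1 <= nth 0 lam i.-2.
  by apply: (sorted_leq_nth geq_trans leqnn _ lam_sorted); rewrite ?inE; lia.
by move: uP; rewrite /part /=; lia.
Qed.

Lemma eq_maj lam S S' : is_partition lam ->
  {in diagram lam, forall u, S u.1 u.2 = S' u.1 u.2} -> maj lam S = maj lam S'.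
Proof. by move=> lamP eqS; rewrite /maj (eq_Des lamP eqS). Qed.

Lemma eq_inv_stat lam S S' : is_partition lam ->
  {in diagram lam, forall u, S u.1 u.2 = S' u.1 u.2} ->
  inv_stat lam S = inv_stat lam S'.
Proof.
move=> lamP eqS; rewrite /inv_stat (eq_Des lamP eqS); congr (_%:Z - _)%R.
rewrite !Inv_sum; apply: eq_big_seq => u uP; apply: eq_big_seq => v vP.
by rewrite /is_inversion !eqS.
Qed.

Lemma restrictE lam S :
  {in diagram lam, forall u, restrict lam S u.1 u.2 = S u.1 u.2}.
Proof. by move=> [i j] uP; rewrite /restrict uP. Qed.

End RowStatistics.

Lemma is_partition_nseq2 l : is_partition (nseq l 2).
Proof.
rewrite /is_partition all_nseq orbT andbT.
by case: l => //= l; elim: l.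
Qed.

(** * Effect of the swaps of [tau] on each row *)

Section Tau.
Implicit Types S : nat -> nat -> nat.

(* [xXxX] says that exactly one of [A], [B] separates [a] from [b]; exchanging
   [A] and [B] is harmless to both statistics precisely when it fails. *)
Lemma xXxX_swap_both a b A B : xXxX a b A B ->
  (a < b) + (A < a) + (B < a) = (b < a) + (B < b) + (A < b).
Proof.
rewrite /xXxX; case: (ltnP a b); case: (ltnP b a); case: (ltnP A a);
case: (ltnP B a); case: (ltnP A b); case: (ltnP B b) => //=; lia.
Qed.

(** Both or neither of [A], [B] separate [a] from [b], so [(A < b) - (A < a)] is the same with [B]
    for [A]. *)
Lemma xXxX_swap_lower a b A B : ~~ xXxX a b A B ->
  (A < a) + (B < b) = (B < a) + (A < b).
Proof.
rewrite /xXxX; case: (ltnP a b); case: (ltnP b a); case: (ltnP A a);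
case: (ltnP B a); case: (ltnP A b); case: (ltnP B b) => //=; lia.
Qed.

Lemma swap_row_id r S i j : i != r -> swap_row r S i j = S i j.
Proof. by rewrite /swap_row => /negPf->. Qed.

Lemma swap_row_succ r S j : swap_row r S r.+1 j = S r.+1 j.
Proof. by rewrite swap_row_id //; lia. Qed.

Lemma swap_row_pred r S j : swap_row r.+1 S r j = S r j.
Proof. by rewrite swap_row_id //; lia. Qed.

Lemma swap_row1 r S : swap_row r S r 1 = S r 2.
Proof. by rewrite /swap_row eqxx. Qed.

Lemma swap_row2 r S : swap_row r S r 2 = S r 1.
Proof. by rewrite /swap_row eqxx. Qed.

Lemma swap_rowK r S i j : swap_row r (swap_row r S) i j = S i j.
Proof.
rewrite /swap_row; case: (eqVneq i r) => //= _.
by case: j => [|[|[|j]]].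
Qed.

Definition eq_row_stats S S' i :=
  row_des S i = row_des S' i /\ row_inv S i = row_inv S' i.

Lemma eq_rows_stats S S' i :
  S i =1 S' i -> S i.+1 =1 S' i.+1 -> eq_row_stats S S' i.
Proof. by move=> e e'; rewrite /eq_row_stats /row_des /row_inv !e !e'. Qed.

Lemma eq_row_stats_trans S1 S2 S3 i :
  eq_row_stats S1 S2 i -> eq_row_stats S2 S3 i -> eq_row_stats S1 S3 i.
Proof. by rewrite /eq_row_stats => -[-> ->]. Qed.

(** The two sides differ by swapping both rows. This only exchanges the columns of the descents, so
    [xXxX] matters for [row_inv] alone. *)
Lemma swap_both_row_stats S i : rows_xXxX S i ->
  eq_row_stats (swap_row i.+1 S) (swap_row i S) i.
Proof.
move/xXxX_swap_both; rewrite /eq_row_stats /row_des /row_inv.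
rewrite !swap_row1 !swap_row2 !swap_row_succ !swap_row_pred.
by do 6 move: (nat_of_bool _) => ?; lia.
Qed.

Lemma swap_lower_row_stats S i : ~~ rows_xXxX S i ->
  eq_row_stats S (swap_row i S) i.
Proof.
move/xXxX_swap_lower; rewrite /eq_row_stats /row_des /row_inv.
rewrite !swap_row1 !swap_row2 !swap_row_succ.
by do 5 move: (nat_of_bool _) => ?; lia.
Qed.

Lemma tau_loop_below n top S i r : r <= i -> tau_loop n top S i r =1 S r.
Proof.
elim: n S i => [|n IHn] S i ri j //=; case: ifP => // _.
by rewrite IHn ?swap_row_id //; lia.
Qed.

(* The loop is entered with row [i] already swapped, so the statistics to be
   preserved are those of [swap_row i S]. *)
Lemma tau_loop_row_stats n top S i r : top <= i + n -> i <= r < top ->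
  eq_row_stats (tau_loop n top S i) (swap_row i S) r.
Proof.
elim: n S i => [|n IHn] S i top_le rP /=; first by lia.
case: ifP => [/andP[_ xX]|stop].
  (* For [r = i], the rest of the loop leaves rows [i] and [i.+1] alone. *)
  have [->|r_neq] := eqVneq r i.
    apply: eq_row_stats_trans (swap_both_row_stats xX).
    by apply: eq_rows_stats; apply: tau_loop_below.
  (* For [r > i], the double swap gives back [S], which agrees with [swap_row i S] above row [i]. *)
  apply: (eq_row_stats_trans (S2 := swap_row i.+1 (swap_row i.+1 S))).
    by apply: IHn; lia.
  by apply: eq_rows_stats => j; rewrite swap_rowK swap_row_id //; lia.
have [r_eq|r_neq] := eqVneq r i; last first.
  by apply: eq_rows_stats => j; rewrite swap_row_id //; lia.
(* As [i < top], the loop can only have stopped because [xXxX] fails. *)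
rewrite r_eq; apply: swap_lower_row_stats; move/negbT: stop.
by rewrite negb_and -ltnNge => /orP[|//]; lia.
Qed.

Lemma tau_below k l S r : r <= k -> tau k l S r =1 S r.
Proof.
move=> rk j; rewrite /tau; case: ifP => // _.
by rewrite tau_loop_below ?swap_row_id //; lia.
Qed.

Lemma tau_row_stats k l S r : k < r < k + l -> eq_row_stats (tau k l S) S r.
Proof.
move=> rP; rewrite /tau; case: ifP => // _.
apply: (eq_row_stats_trans (S2 := swap_row k.+1 (swap_row k.+1 S))).
  by apply: tau_loop_row_stats; lia.
by apply: eq_rows_stats => j; rewrite swap_rowK.
Qed.

(** Exactly one of [a], [b] exceeds [A], and it is the larger one. *)
Lemma xAx_swap a b A : xAx a b A -> (a < b) + (A < a) = (b < a) + (A < b).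
Proof.
rewrite /xAx; case: (ltnP a b); case: (ltnP b a); case: (ltnP A a);
case: (ltnP A b) => //=; lia.
Qed.

Lemma xAxN a b A : ~~ xAx a b A -> (A < a) = (A < b).
Proof. by rewrite /xAx; case: (ltnP A a); case: (ltnP A b) => //=; lia. Qed.

(** In both branches row [k.+1] keeps only the inner inversion it had in [S], as if no row lay
    beneath it. *)
Lemma tau_row_inv k l S :
  row_inv (tau k l S) k = (S k.+1 2 < S k.+1 1)%:Z%R.
Proof.
rewrite /tau /rows_xAx; case: ifP => [/xAx_swap|/negbT/xAxN]; rewrite /row_inv.
  rewrite !tau_loop_below // swap_row1 swap_row2 swap_row_pred => ->.
  by rewrite PoszD GRing.addrK.
by move=> ->; rewrite PoszD GRing.addrK.
Qed.

End Tau.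

Theorem theorem4 (k l : nat) (mu' : seq nat) (T : nat -> nat -> nat)
    (hk : 1 <= k) (hl : 1 <= l)
    (hmu' : is_partition mu') (hsize : size mu' = k) (hlast : 2 <= part mu' k)
    (hT : is_filling (mu' ++ nseq l 2) T) :
  maj (mu' ++ nseq l 2) (tau k l T)
    = maj mu' (lower_part mu' T) + maj (nseq l 2) (upper_part k l T) %[mod l]
  /\
  inv_stat (mu' ++ nseq l 2) (tau k l T)
    = (inv_stat mu' (lower_part mu' T) + inv_stat (nseq l 2) (upper_part k l T))%R.
Proof.
have lowerE : {in diagram mu', forall u,
    tau k l T u.1 u.2 = lower_part mu' T u.1 u.2}.
  move=> [i j] uP; rewrite /lower_part restrictE // tau_below //.
  by move: uP; rewrite mem_diagram hsize /=; lia.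
pose T_up i j := T (k + i) j.
have upperE : {in diagram (nseq l 2), forall u,
    upper_part k l T u.1 u.2 = T_up u.1 u.2} by exact: restrictE.
have upperP := is_partition_nseq2 l.
split.
  rewrite maj_cat_nseq ?hsize // (eq_maj hmu' lowerE) (eq_maj upperP upperE).
  rewrite maj_nseq; congr ((_ + _) %% _); apply: eq_big_nat => i iP.
  have [-> _] : eq_row_stats (tau k l T) T (k + i).
    by apply: tau_row_stats; lia.
  by rewrite /row_des /T_up addnS.
rewrite inv_stat_cat_nseq ?hsize; last by apply: leq_trans hlast.
rewrite (eq_inv_stat hmu' lowerE) (eq_inv_stat upperP upperE).
(* The term [i = 0] is row [k.+1], matched with the bottom row of [T_up]. *)
rewrite inv_stat_nseq // big_ltn // addn0 tau_row_inv /T_up addn1.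
congr (_ + (_ + _))%R; apply: eq_big_nat => i iP.
have [_ ->] : eq_row_stats (tau k l T) T (k + i).
  by apply: tau_row_stats; lia.
by rewrite /row_inv /T_up addnS.
Qed.
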